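(* Let $n\ge 1$ and $f\in \mathrm{Pol}_n=\mathbb{Z}[x_1,\ldots,x_n]$. Then $f$ is quasisymmetric (that is, $f\in \mathrm{QSym}_n$) if and only if $\mathsf{T}_1f=\cdots=\mathsf{T}_{n-1}f=0$.
   Context: $\mathrm{Pol}=\mathbb{Z}[x_1,x_2,\ldots]$ and $\mathrm{Pol}_n=\mathbb{Z}[x_1,\ldots,x_n]\subset \mathrm{Pol}$. For $i\ge 1$ define $\mathsf{R}_i:\mathrm{Pol}\to\mathrm{Pol}$ by $\mathsf{R}_i(f)=f(x_1,\ldots,x_{i-1},0,x_i,x_{i+1},\ldots)$ (set $x_i=0$ and replace $x_j$ by $x_{j-1}$ for all $j\ge i+1$), and define $\mathsf{T}_i:\mathrm{Pol}\to\mathrm{Pol}$ by $\mathsf{T}_i(f)=\dfrac{\mathsf{R}_{i+1}(f)-\mathsf{R}_i(f)}{x_i}$ (this is always a polynomial). $\mathrm{QSym}_n\subset \mathrm{Pol}_n$ is the set of polynomials such that for every sequence $a_1,\ldots,a_k\ge 1$ the coefficients of $x_{i_1}^{a_1}\cdots x_{i_k}^{a_k}$ and $x_{j_1}^{a_1}\cdots x_{j_k}^{a_k}$ are equal whenever $1\le i_1<\cdots<i_k\le n$ and $1\le j_1<\cdots<j_k\le n$. *)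

(* Defs.v *)
From mathcomp Require Import all_boot all_order all_algebra.
From mathcomp Require Import finmap monalg.

Set Implicit Arguments.
Unset Strict Implicit.
Unset Printing Implicit Defensive.

Import GRing.Theory.
Local Open Scope ring_scope.

(* Variables are indexed from 0: the nat [i] stands for the variable x_(i+1),
   and likewise [Rop i] and [Top i] below stand for R_(i+1) and T_(i+1). *)
Notation Pol := {malg int[{cmonom nat}]}.

Definition var (i : nat) : Pol := << ucm i >>.

(* The polynomial obtained from [f] by substituting [s j] for each variable j. *)
Definition subst (s : nat -> Pol) (f : Pol) : Pol :=
  mmap (@malgC {cmonom nat} int)
       (fun m : {cmonom nat} => \prod_(j <- finsupp m) s j ^+ m j) f.

Definition Rop (i : nat) : Pol -> Pol :=
  subst (fun j => if (j < i)%N then var j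
                  else if j == i then 0 else var j.-1).

(* Quotient by the variable [i], discarding the monomials it does not divide;
   [Top] only applies it to multiples of [var i], see [mulXT]. *)
Definition divX (i : nat) (f : Pol) : Pol :=
  mmap (@malgC {cmonom nat} int)
       (fun m : {cmonom nat} =>
          if m i == 0%N then 0 else << divcm m (ucm i) >>) f.

Definition Top (i : nat) (f : Pol) : Pol := divX i (Rop i.+1 f - Rop i f).

Definition inPol (n : nat) (f : Pol) : Prop :=
  forall (m : {cmonom nat}) (j : nat),
    m \in msupp f -> j \in finsupp m -> (j < n)%N.

Definition monom (k : nat) (v a : 'I_k -> nat) : {cmonom nat} :=
  \big[@mmul {cmonom nat}/@mone {cmonom nat}]_(p < k) expcmn (ucm (v p)) (a p).

Definition inQSym (n : nat) (f : Pol) : Prop :=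
  inPol n f /\
  forall (k : nat) (a : 'I_k -> nat) (v w : 'I_k -> 'I_n),
    (forall p, 1 <= a p)%N ->
    {homo v : p q / (p < q)%N} -> {homo w : p q / (p < q)%N} ->
    f@_(monom v a) = f@_(monom w a).

Lemma divXK (i : nat) (g : Pol) : divX i (var i * g) = g.
Proof.
rewrite /divX {1}[g]monalgE mulr_sumr raddf_sum /= [RHS]monalgE.
apply: eq_bigr => m _; rewrite /var malgM_def fgmulUU mul1r mmapU.
have E j : mmul (ucm i) m j = ((i == j) + m j)%N by rewrite mulcmE ucmE.
rewrite E eqxx /= malgM_def fgmulUU mulr1 mul1m.
suff -> : divcm (mmul (ucm i) m) (ucm i) = m by [].
by apply/eqP/cmP => j; rewrite divcmE E ucmE addKn.
Qed.

(* [eqmodr x] is congruence modulo the principal ideal generated by [x]. *)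
Definition eqmodr (A : comNzRingType) (x p q : A) : Prop :=
  exists g, p - q = x * g.

Lemma eqmodr_refl (A : comNzRingType) (x p : A) : eqmodr x p p.
Proof. by exists 0; rewrite mulr0 subrr. Qed.

Lemma eqmodrD (A : comNzRingType) (x p p' q q' : A) :
  eqmodr x p p' -> eqmodr x q q' -> eqmodr x (p + q) (p' + q').
Proof.
by move=> [g Hg] [h Hh]; exists (g + h); rewrite mulrDr -Hg -Hh opprD addrACA.
Qed.

Lemma eqmodrM (A : comNzRingType) (x p p' q q' : A) :
  eqmodr x p p' -> eqmodr x q q' -> eqmodr x (p * q) (p' * q').
Proof.
move=> [g Hg] [h Hh]; exists (g * q + p' * h).
by rewrite mulrDr (mulrCA x p') mulrA -Hg -Hh mulrBl mulrBr addrA subrK.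
Qed.

Lemma eqmodrX (A : comNzRingType) (x p q : A) (e : nat) :
  eqmodr x p q -> eqmodr x (p ^+ e) (q ^+ e).
Proof.
move=> pq; elim: e => [|e IHe]; first by rewrite !expr0; apply: eqmodr_refl.
by rewrite !exprS; apply: eqmodrM.
Qed.

Lemma subst_eqmodr (x : Pol) (s t : nat -> Pol) (f : Pol) :
  (forall j, eqmodr x (s j) (t j)) -> eqmodr x (subst s f) (subst t f).
Proof.
move=> st; rewrite /subst /mmap.
apply: (big_ind2 (eqmodr x)); first exact: eqmodr_refl.
  by move=> ? ? ? ?; apply: eqmodrD.
move=> m _; apply: eqmodrM; first exact: eqmodr_refl.
apply: (big_ind2 (eqmodr x)); first exact: eqmodr_refl.
  by move=> ? ? ? ?; apply: eqmodrM.
by move=> j _; apply/eqmodrX/st.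
Qed.

Lemma mulXT (i : nat) (f : Pol) : var i * Top i f = Rop i.+1 f - Rop i f.
Proof.
suff [g Hg] : eqmodr (var i) (Rop i.+1 f) (Rop i f) by rewrite /Top Hg divXK.
apply: subst_eqmodr => j; rewrite ltnS leq_eqVlt.
case: (ltngtP j i) => [_|ltij|->] /=; first exact: eqmodr_refl.
  case: eqP => [->|_]; last exact: eqmodr_refl.
  by exists (- 1); rewrite sub0r mulrN1.
by exists 1; rewrite subr0 mulr1.
Qed.

(* Main.v *)
Require Import Defs.
From mathcomp Require Import all_boot all_order all_algebra.
From mathcomp Require Import finmap monalg.
From mathcomp Require Import zify.
Import GRing.Theory.
Local Open Scope ring_scope.

(** [Rop i] kills the monomials that involve the variable [i] and closes the
    gap in the others, so the coefficient of [Rop i f] at [m] is that of [f] at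
    the monomial obtained from [m] by reopening a gap at [i], i.e. by renaming
    the variables along [bump i] ([mcoeff_Rop]). As [Top i f] is the
    quotient of [Rop i.+1 f - Rop i f] by [var i], it vanishes exactly when these two
    polynomials agree, that is, when [f] has the same coefficient at [bump i.+1] and at [bump i] applied to any monomial
    ([Top_eq0P]). Such a pair of monomials has equal exponent sequences, and
    differs by sliding at most one variable, [i] against [i.+1].

    If [f] is quasisymmetric in [n] variables, a monomial [m] in the first
    [n - 1] variables is written with increasing variables ([monomP]); both
    reopenings stay within [n] variables and quasisymmetry equates their
    coefficients. If [m] uses a variable beyond these, both reopenings use one
    beyond the [n] variables of [f], and both coefficients vanish.

    Conversely, slides preserve coefficients, and any increasing family of [k]
    variables below [n] can be slid down, one step at a time, to
    [0, 1, ..., k - 1] ([monom_pack]). So every coefficient depends only on the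
    exponent sequence. *)

(** * Arithmetic of monomials *)

Implicit Types (m : {cmonom nat}) (f : Pol) (g h : nat -> nat).

Lemma expcmnE (m : {cmonom nat}) (e : nat) : expcmn m e = iter e (mmul m) mone.
Proof. exact: (@Monoid.iteropE _ mone mmul). Qed.

Lemma cm_expE (m : {cmonom nat}) (e j : nat) : expcmn m e j = (e * m j)%N.
Proof.
by rewrite expcmnE; elim: e => [|e IHe] /=; rewrite ?cm1 // cmM IHe mulSn.
Qed.

Lemma cm_prodE (T : Type) (r : seq T) (F : T -> {cmonom nat}) (j : nat) :
  (\big[@mmul {cmonom nat}/@mone {cmonom nat}]_(x <- r) F x) j
  = (\sum_(x <- r) F x j)%N.
Proof. by elim/big_rec2: _ => [|x s m _ <-]; rewrite ?cm1 ?cmM. Qed.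

Lemma malgU_mul (m1 m2 : {cmonom nat}) :
  << mmul m1 m2 >> = << m1 >> * << m2 >> :> Pol.
Proof. by rewrite malgM_def fgmulUU mulr1. Qed.

Lemma malgU_exp (m : {cmonom nat}) (e : nat) :
  << expcmn m e >> = << m >> ^+ e :> Pol.
Proof.
rewrite expcmnE.
by elim: e => [|e IHe] /=; rewrite ?expr0 // malgU_mul IHe exprS.
Qed.

(** * Renaming the variables of a monomial *)

(** Variables with the same image are merged: their exponents add up. This
    makes [relabel g] a monoid morphism for every [g], not only injective ones. *)
Definition relabel (g : nat -> nat) (m : {cmonom nat}) : {cmonom nat} :=
  \big[@mmul {cmonom nat}/@mone {cmonom nat}]_(j <- finsupp m)
     expcmn (ucm (g j)) (m j).

Lemma relabelE g m k : relabel g m k = (\sum_(j <- finsupp m) m j * (g j == k))%N.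
Proof. by rewrite cm_prodE; apply: eq_bigr => j _; rewrite cm_expE ucmE. Qed.

(** Summing over a larger support lets [relabelM] compare two monomials
    index by index. *)
Lemma relabelEw (d : {fset nat}) g m k : (finsupp m `<=` d)%fset ->
  relabel g m k = (\sum_(j <- d) m j * (g j == k))%N.
Proof.
move=> md; rewrite relabelE; apply: big_fset_incl md _ => j _.
by rewrite -cmE_eq0 => /eqP->.
Qed.

Lemma relabel_id m : relabel id m = m.
Proof.
apply/eqP/cmP => k; rewrite relabelE.
have [kS|kS] := boolP (k \in finsupp m).
  rewrite (big_fsetD1 k) //= eqxx muln1 big_seq big1 ?addn0 // => j.
  by rewrite in_fsetD1 => /andP[/negbTE-> _]; rewrite muln0.
rewrite big_seq big1 => [|j jS].
  by move: kS; rewrite -cmE_eq0 => /eqP->.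
by case: eqP kS => [<-|_ _]; rewrite ?jS ?muln0.
Qed.

Lemma relabel1 g : relabel g mone = mone.
Proof. by rewrite /relabel mdom1 big_seq_fset0. Qed.

Lemma relabelM g m1 m2 : relabel g (mmul m1 m2) = mmul (relabel g m1) (relabel g m2).
Proof.
apply/eqP/cmP => k; rewrite cmM; set d := (finsupp m1 `|` finsupp m2)%fset.
rewrite !(@relabelEw d) ?fsubsetUl ?fsubsetUr ?mdomD //.
by rewrite -big_split; apply: eq_bigr => j _; rewrite cmM mulnDl.
Qed.

Lemma relabel_exp g j e : relabel g (expcmn (ucm j) e) = expcmn (ucm (g j)) e.
Proof.
have relabelU : relabel g (ucm j) = ucm (g j).
  by rewrite /relabel mdomU big_seq_fset1 cmUU.
rewrite !expcmnE.
by elim: e => [|e IHe] /=; rewrite ?relabel1 // relabelM IHe relabelU.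
Qed.

Lemma relabel_prod g (T : Type) (r : seq T) (v a : T -> nat) :
  relabel g (\big[@mmul {cmonom nat}/@mone {cmonom nat}]_(x <- r)
               expcmn (ucm (v x)) (a x))
  = \big[@mmul {cmonom nat}/@mone {cmonom nat}]_(x <- r)
       expcmn (ucm (g (v x))) (a x).
Proof.
rewrite (big_morph _ (relabelM g) (relabel1 g)).
by apply: eq_bigr => x _; rewrite relabel_exp.
Qed.

Lemma relabel_comp g h m : relabel g (relabel h m) = relabel (g \o h) m.
Proof. exact: relabel_prod. Qed.

Lemma relabel_monom g k (v a : 'I_k -> nat) :
  relabel g (monom v a) = monom (g \o v) a.
Proof. exact: relabel_prod. Qed.

Lemma eq_in_relabel g h m :
  (forall j, j \in finsupp m -> g j = h j) -> relabel g m = relabel h m.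
Proof. by move=> gh; apply: eq_big_seq => j /gh ->. Qed.

Lemma relabel_finsupp g m j :
  j \in finsupp m -> g j \in finsupp (relabel g m).
Proof.
rewrite -!cmE_neq0 relabelE => mj.
rewrite (big_fsetD1 j) -?cmE_neq0 //=.
by rewrite eqxx muln1 addn_eq0 (negbTE mj).
Qed.

Lemma relabel_bump_at i m : relabel (bump i) m i = 0%N.
Proof.
by rewrite relabelE big1 // => j _; rewrite eq_sym (negbTE (neq_bump i j)) muln0.
Qed.

(** Closing the gap at [i] undoes opening it, and opening undoes closing as
    soon as the variable [i] does not occur. *)
Lemma relabel_bumpP i (m m' : {cmonom nat}) :
  (m' == relabel (bump i) m) = (m' i == 0%N) && (relabel (unbump i) m' == m).
Proof.
apply/eqP/andP => [->|[/eqP m'i /eqP<-]].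
  rewrite relabel_bump_at relabel_comp; split=> //.
  rewrite -[eqbRHS]relabel_id; apply/eqP/eq_in_relabel => j _.
  exact: bumpK.
rewrite relabel_comp -[LHS]relabel_id; apply: eq_in_relabel => j.
rewrite -cmE_neq0 => m'j; rewrite /= unbumpKcond.
by case: (eqVneq j i) m'j => [->|//]; rewrite m'i.
Qed.

(** * The operators on coefficients *)

(** A monomial contributes to [Rop i f] at [m] exactly when it avoids the
    variable [i] and closes up to [m]; by [relabel_bumpP] there is a single such
    monomial. *)
Lemma mcoeff_Rop i (f : Pol) m : (Rop i f)@_m = f@_(relabel (bump i) m).
Proof.
rewrite /Rop /subst mmapE [in RHS](monalgE f) !raddf_sum /=.
apply: eq_bigr => k _; rewrite mcoeffCM mcoeffU -mulr_natr relabel_bumpP.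
congr (_ * _); have [ki|ki] := eqVneq (k i) 0%N; last first.
  (* The variable [i] occurs in [k], hence a factor [0 ^+ k i] with [k i != 0]. *)
  rewrite (big_fsetD1 i) ?cmE_neq0 //=; last by rewrite -cmE_neq0.
  by rewrite ltnn eqxx expr0n (negbTE ki) mul0r mcoeff0.
rewrite -mcoeffU1; congr (_@__); rewrite /relabel.
rewrite (big_morph (fun x : {cmonom nat} => << x >> : Pol) malgU_mul (erefl _)).
apply: eq_big_seq => j; rewrite -cmE_neq0 => kj.
rewrite malgU_exp; congr (GRing.exp _ (k j)); rewrite /var /unbump.
case: (ltngtP j i) kj => [_ _|_ _|->].
- by rewrite subn0.
- by rewrite subn1.
by rewrite ki.
Qed.

(** Vanishing of [Top i] is invariance of the coefficients under the slide
    that exchanges an unused variable [i] with its successor. *)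
Lemma Top_eq0P i (f : Pol) :
  Top i f = 0 <->
  forall m, f@_(relabel (bump i.+1) m) = f@_(relabel (bump i) m).
Proof.
split=> [Tf m|slide].
  by apply/eqP; rewrite -!mcoeff_Rop -subr_eq0 -mcoeffB -mulXT Tf mulr0 mcoeff0.
have RR : Rop i.+1 f = Rop i f.
  by apply/malgP => m; move: (slide m); rewrite -(mcoeff_Rop i.+1) -(mcoeff_Rop i).
rewrite /Top RR subrr; exact: raddf0.
Qed.

(** * Increasing families of variables *)

(** The normal form behind quasisymmetry: listing the support in increasing
    order reads off the exponent sequence. *)
Lemma monomP n (m : {cmonom nat}) :
  (forall j, j \in finsupp m -> (j < n)%N) ->
  exists k (a : 'I_k -> nat) (v : 'I_k -> 'I_n),
    [/\ forall p, (1 <= a p)%N, {homo v : p q / (p < q)%N} & m = monom v a].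
Proof.
move=> mn; pose s := [seq j <- iota 0 n | m j != 0%N].
have sP j : (j \in s) = (j \in finsupp m).
  rewrite mem_filter mem_iota /= cmE_neq0 andb_idr // => /mn; lia.
have sn (p : 'I_(size s)) : (nth 0%N s p < n)%N by apply/mn; rewrite -sP mem_nth.
exists (size s), (fun p => m (nth 0%N s p)), (fun p => Ordinal (sn p)); split.
- by move=> p; rewrite lt0n cmE_neq0 -sP mem_nth.
- have s_sorted : sorted ltn s.
    by apply: sorted_filter (iota_ltn_sorted 0 n); apply: ltn_trans.
  by move=> p q; apply: (sorted_ltn_nth ltn_trans) s_sorted _ _ _ _; rewrite inE.
rewrite -[LHS]relabel_id /relabel (perm_big s) /=.
  by rewrite (big_nth 0%N) big_mkord.
apply: uniq_perm; rewrite ?fset_uniq ?filter_uniq ?iota_uniq // => j.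
by rewrite sP.
Qed.

(** Induction on the sum of the indices of the variables. Unless [v] is already
    [0, ..., k - 1], let [p] be its first position with [v p != p]: then
    [v p > p], and the variable just below [v p] is unused, so [v p] slides
    down by one without changing the coefficient. *)
Lemma monom_pack n k (f : Pol) (v a : 'I_k -> nat) :
  (forall i, (i.+1 < n)%N -> Top i f = 0) ->
  (forall p, v p < n)%N -> {homo v : p q / (p < q)%N} ->
  f@_(monom v a) = f@_(monom (@nat_of_ord k) a).
Proof.
move=> Tf; have [s] := ubnP (\sum_p v p)%N.
elim: s v => // s IHs v; rewrite ltnS => vs vn vhomo.
have vge (p : 'I_k) : (p <= v p)%N.
  case: p; elim=> [//|q IHq] qk.
  apply: leq_ltn_trans (IHq (ltnW qk)) _.
  exact: (vhomo (Ordinal (ltnW qk)) (Ordinal qk) (ltnSn q)).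
have [vid|] := boolP [forall p : 'I_k, v p == p].
  by congr (_@__); apply: eq_bigr => p _; rewrite (eqP (forallP vid p)).
rewrite negb_forall => /existsP[p0 p0P].
have [p vp pmin] := @arg_minnP _ p0 (fun p : 'I_k => v p != p) val p0P.
have vid (q : 'I_k) : (q < p)%N -> v q = q.
  by move=> qp; apply/eqP; apply: contraTT qp => /pmin; rewrite -leqNgt.
pose i := (v p).-1; have vpE : v p = i.+1 by have := vge p; lia.
have ip : (p <= i)%N by have := vge p; lia.
pose v' := unbump i \o v.
(* The family [v] avoids [i]: before [p] its values are smaller than [p], and
   from [p] on they are at least [v p]. *)
have vi q : v q != i.
  have [/[dup]/vid-> |] := ltnP q p; first lia.
  by rewrite leq_eqVlt => /predU1P[/val_inj <-|/vhomo]; lia.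
have -> : monom v a = relabel (bump i) (monom v' a).
  rewrite relabel_monom; apply: eq_bigr => q _; congr (expcmn (ucm _) _).
  by rewrite /v' /= unbumpKcond (negbTE (vi q)).
have := vn p; rewrite vpE => /Tf/Top_eq0P<-; rewrite relabel_monom.
(* Reopening the gap at [i.+1] instead of [i] moves only the variable [i.+1]. *)
set w := _ \o v'; have wE q : w q = if v q == i.+1 then i else v q.
  by rewrite /w /v' /= /bump /unbump; have := vi q; case: ifP; lia.
apply: IHs => [|q|q r /vhomo]; rewrite ?wE.
- apply: leq_trans vs; rewrite (bigD1 p) // [ltnRHS](bigD1 p) //= -addSn.
  apply: leq_add; first by rewrite wE vpE eqxx.
  by apply: leq_sum => q _; rewrite wE; case: ifP; lia.
- by have := vn q; case: ifP; lia.
- by have := vi q; have := vi r; do 2 case: ifP; lia.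
Qed.

Theorem theorem2p6 (n : nat) (hn : (1 <= n)%N) (f : Pol) (hf : inPol n f) :
  inQSym n f <-> (forall i : nat, (i.+1 < n)%N -> Top i f = 0).
Proof.
case: n hn hf => // n _ hf; split=> [[_ fQ] i ilt | Tf].
  apply/Top_eq0P => m.
  (* The number of variables is now [n.+1]; [m] fits when it uses only [n]. *)
  have [mn|] := boolP (all (fun j => j < n)%N (finsupp m)).
    have [k [a [v [a1 vhomo ->]]]] := @monomP n m (allP mn).
    have lift_homo (h : 'I_n.+1) : {homo lift h \o v : p q / (p < q)%N}.
      by move=> p q /vhomo; rewrite /= /bump; lia.
    have iltn : (i < n.+1)%N by lia.
    (* [lift] is [bump] with its bound: the gaps are opened inside [n.+1]. *)
    rewrite !relabel_monom.
    exact: (fQ k a (lift (Ordinal ilt) \o v) (lift (Ordinal iltn) \o v)).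
  case/allPn => j jm; rewrite -leqNgt => nj.
  (* Opening a gap at or below [i.+1 <= j] pushes the variable [j >= n] to
     [j.+1], which does not occur in [f]. *)
  suff f0 (h : nat) : (h <= i.+1)%N -> f@_(relabel (bump h) m) = 0 by rewrite !f0.
  move=> hi; apply: mcoeff_outdom; apply/negP => mf.
  by have := hf _ _ mf (relabel_finsupp (bump h) m j jm); rewrite /bump; lia.
split=> // k a v w _ vhomo whomo.
have pack (u : 'I_k -> 'I_n.+1) : {homo u : p q / (p < q)%N} ->
    f@_(monom u a) = f@_(monom (@nat_of_ord k) a).
  by apply: monom_pack Tf _ => p; apply: ltn_ord.
by rewrite !pack.
Qed.
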